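(* Let $\Phi$, $g$, $f=\Phi-g$, $L_{yx}$, $L_{yy}$ satisfy the standing assumptions in the context with $\nu>0$, and let $(x^*,y^* )$ be a saddle-point of $f$. Let $c_\alpha>L_{yx}\ge0$, let $\theta_0=1$, and let $\tau_0,\sigma_0>0$ be such that $$(c_\alpha L_{yx}\tau_0+2L_{yy})\sigma_0<1\quad\text{and}\quad 0<\sigma_0\le\frac{9+3\sqrt{13}}{2\nu}.$$ Define, for every $k\in\mathbb{N}$, $$\theta_{k+1}=\frac{1}{\sqrt{1+\nu\sigma_k}},\quad\tau_{k+1}=\frac{\tau_k}{\theta_{k+1}},\quad\sigma_{k+1}=\theta_{k+1}\sigma_k.$$ Let $((x^k,y^k))_{k\in\mathbb{N}}$ be generated by OGAProx (see context) with these parameters, and let $\hat{x}_k,\hat{y}_k$ ($k\ge1$) be the ergodic averages defined in the context. Then: (i) $((x^k,y^k))_{k\in\mathbb{N}}$ and $((\hat{x}_{k+1},\hat{y}_{k+1}))_{k\in\mathbb{N}}$ are bounded. (ii) For every $k\in\mathbb{N}\smallsetminus\{0\}$, $$-\frac{6}{\nu\sigma_0k^2}\left(\frac{1}{\tau_0}\|\hat{x}_k-x^0\|^2+\frac{1}{\sigma_0}\|y^*-y^0\|^2\right)\le f(\hat{x}_k,\hat{y}_k)-f(x^*,y^* )\le\frac{6}{\nu\sigma_0k^2}\left(\frac{1}{\tau_0}\|x^*-x^0\|^2+\frac{1}{\sigma_0}\|\hat{y}_k-y^0\|^2\right).$$ Consequently, $(f(\hat{x}_k,\hat{y}_k))_{k\ge1}$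 converges to $f(x^*,y^* )$ with rate $\mathcal{O}\left(\frac{1}{k^2}\right)$, i.e. $|f(\hat{x}_k,\hat{y}_k)-f(x^*,y^* )|=\mathcal{O}\left(\frac1{k^2}\right)$.
   Context: $\mathbb{N}=\{0,1,2,\dots\}$. $\mathcal{H}_1,\mathcal{H}_2$ are real Hilbert spaces; $\Phi:\mathcal{H}_1\times\mathcal{H}_2\to\mathbb{R}\cup\{+\infty\}$ with $\operatorname{dom}\Phi=\{(x,y):\Phi(x,y)<+\infty\}\ne\varnothing$; $g:\mathcal{H}_2\to\mathbb{R}\cup\{+\infty\}$; $f(x,y)=\Phi(x,y)-g(y)$. Set $P=\{u\in\mathcal{H}_1:\exists y\in\mathcal{H}_2,\ (u,y)\in\operatorname{dom}\Phi\}$. Standing assumptions: - $g$ is proper, lower semicontinuous, and convex with modulus $\nu\ge0$, i.e. $g-\frac{\nu}{2}\|\cdot\|^2$ is convex. - For every $y\in\operatorname{dom}g$, $\Phi(\cdot,y):\mathcal{H}_1\to\mathbb{R}\cup\{+\infty\}$ is proper, convex and lower semicontinuous. - $P$ is closed, and for every $x\in P$, $\operatorname{dom}\Phi(x,\cdot)=\mathcal{H}_2$ and $\Phi(x,\cdot):\mathcal{H}_2\to\mathbb{R}$ is concave and Fréchet differentiable. - There are $L_{yx},L_{yy}\ge0$ such that for all $(x,y),(x',y')\in P\times\operatorname{dom}g$: $\|\nabla_y\Phi(x,y)-\nabla_y\Phi(x',y')\|\le L_{yx}\|x-x'\|+L_{yy}\|y-y'\|$. - $f$ has a saddle-point, i.e.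 a point $(x^*,y^* )\in\mathcal{H}_1\times\mathcal{H}_2$ with $f(x^*,y)\le f(x^*,y^* )\le f(x,y^* )$ for all $(x,y)\in\mathcal{H}_1\times\mathcal{H}_2$. Proximity operator: $\operatorname{Prox}_h(x)=\operatorname{argmin}_{y}\left(h(y)+\frac12\|x-y\|^2\right)$ for $h$ proper, convex, lower semicontinuous. OGAProx: given $(x^0,y^0)\in P\times\operatorname{dom}g$, $(x^{-1},y^{-1}):=(x^0,y^0)$, and parameters $\sigma_k,\tau_k>0$, $\theta_k\in(0,1]$, for every $k\in\mathbb{N}$: $$y^{k+1}=\operatorname{Prox}_{\sigma_kg}\big(y^k+\sigma_k[(1+\theta_k)\nabla_y\Phi(x^k,y^k)-\theta_k\nabla_y\Phi(x^{k-1},y^{k-1})]\big),\qquad x^{k+1}=\operatorname{Prox}_{\tau_kf(\cdot,y^{k+1})}(x^k).$$ Ergodic averages: $t_k=\frac{\theta_0}{\theta_0\theta_1\cdots\theta_k}$ for $k\in\mathbb{N}$, and for $k\ge1$, $\hat{x}_k=\frac{1}{\sum_{i=0}^{k-1}t_i}\sum_{j=0}^{k-1}t_jx^{j+1}$, $\hat{y}_k=\frac{1}{\sum_{i=0}^{k-1}t_i}\sum_{j=0}^{k-1}t_jy^{j+1}$. *)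

(* Defs.v *)
From HB Require Import structures.
From mathcomp Require Import all_boot all_order all_algebra sesquilinear.
From mathcomp Require Import all_classical all_reals all_analysis.

Set Implicit Arguments.
Unset Strict Implicit.
Unset Printing Implicit Defensive.

Import Order.TTheory GRing.Theory Num.Theory.
Import numFieldNormedType.Exports.

Local Open Scope classical_set_scope.
Local Open Scope ring_scope.
Local Open Scope ereal_scope.

(* A real Hilbert space is a complete normed space [H] together with an inner
   product [ip : {dot H for idfun}] satisfying [hilbert_inner ip]. *)
Definition hilbert_inner (R : realType) (H : completeNormedModType R)
    (ip : {dot H for idfun}) : Prop :=
  forall v : H, (ip v v = `|v| ^+ 2)%R.

(* Fréchet gradient: the Riesz representative of the differential. The value is
   meaningful only where [F] is differentiable. *)
Definition gradient (R : realType) (H : completeNormedModType R)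
    (ip : {dot H for idfun}) (F : H -> R^o) (y : H) : H :=
  get [set v : H | forall h : H, 'd F y h = ip v h].

Definition edom (R : realType) (T : Type) (h : T -> \bar R) : set T :=
  [set x | h x < +oo].

Definition eproper (R : realType) (T : Type) (h : T -> \bar R) : Prop :=
  (forall x, h x != -oo) /\ edom h !=set0.

(* Used only for functions that do not take the value -oo, so that the
   right-hand side never involves +oo - oo. *)
Definition econvex (R : realType) (V : lmodType R) (h : V -> \bar R) : Prop :=
  forall (x y : V) (t : R), (0 <= t <= 1)%R ->
    h (t *: x + (1 - t) *: y)%R <= t%:E * h x + (1 - t)%:E * h y.

Definition convex_modulus (R : realType) (V : normedModType R) (nu : R)
    (h : V -> \bar R) : Prop :=
  econvex (fun x => h x - (nu / 2 * `|x| ^+ 2)%:E).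

Definition argmin (R : realType) (T : Type) (h : T -> \bar R) : set T :=
  [set p | forall q, h p <= h q].

Definition prox (R : realType) (V : normedModType R) (h : V -> \bar R)
    (x : V) : set V :=
  argmin (fun y => h y + (2^-1 * `|x - y| ^+ 2)%:E).

(* The dual addition of [\bar R] is used: it fixes +oo - (+oo) = +oo. *)
Definition objective (R : realType) (T1 T2 : Type) (Phi : T1 -> T2 -> \bar R)
    (g : T2 -> \bar R) (x : T1) (y : T2) : \bar R :=
  (Phi x y - g y)%dE.

Definition saddle_point (R : realType) (T1 T2 : Type) (f : T1 -> T2 -> \bar R)
    (xs : T1) (ys : T2) : Prop :=
  forall x y, f xs y <= f xs ys /\ f xs ys <= f x ys.

Definition proj_dom (R : realType) (T1 T2 : Type) (Phi : T1 -> T2 -> \bar R) :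
    set T1 :=
  [set u | exists y, Phi u y < +oo].

Definition grad2 (R : realType) (T1 : Type) (H2 : completeNormedModType R)
    (ip2 : {dot H2 for idfun}) (Phi : T1 -> H2 -> \bar R) (x : T1) (y : H2) :
    H2 :=
  gradient ip2 (fun z => fine (Phi x z)) y.

Record standing_assumptions (R : realType) (H1 H2 : completeNormedModType R)
    (ip2 : {dot H2 for idfun}) (Phi : H1 -> H2 -> \bar R) (g : H2 -> \bar R)
    (nu Lyx Lyy : R) : Prop := StandingAssumptions {
  sa_Phi_gtNy : forall x y, Phi x y != -oo ;
  sa_dom_Phi : exists x y, Phi x y < +oo ;
  sa_g_proper : eproper g ;
  sa_g_lsc : lower_semicontinuous g ;
  sa_nu_ge0 : (0 <= nu)%R ;
  sa_g_convex : convex_modulus nu g ;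
  sa_Phi_proper : forall y, edom g y -> eproper (Phi ^~ y) ;
  sa_Phi_convex : forall y, edom g y -> econvex (Phi ^~ y) ;
  sa_Phi_lsc : forall y, edom g y -> lower_semicontinuous (Phi ^~ y) ;
  sa_P_closed : closed (proj_dom Phi) ;
  sa_Phi_dom : forall x, proj_dom Phi x -> edom (Phi x) = setT ;
  sa_Phi_concave : forall x, proj_dom Phi x -> econvex (fun y => - Phi x y) ;
  sa_Phi_diff : forall x y, proj_dom Phi x ->
    differentiable (fun z => fine (Phi x z) : R^o) y ;
  sa_Lyx_ge0 : (0 <= Lyx)%R ;
  sa_Lyy_ge0 : (0 <= Lyy)%R ;
  sa_grad_lipschitz : forall x x' y y',
    proj_dom Phi x -> edom g y -> proj_dom Phi x' -> edom g y' ->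
    (`|grad2 ip2 Phi x y - grad2 ip2 Phi x' y'|
       <= Lyx * `|x - x'| + Lyy * `|y - y'|)%R ;
  sa_saddle : exists xs ys, saddle_point (objective Phi g) xs ys
}.

(* The predecessor [k.-1] satisfies [0.-1 = 0], which encodes the convention
   (x^{-1}, y^{-1}) = (x^0, y^0). *)
Definition OGAProx (R : realType) (H1 H2 : completeNormedModType R)
    (ip2 : {dot H2 for idfun}) (Phi : H1 -> H2 -> \bar R) (g : H2 -> \bar R)
    (sigma tau theta : nat -> R) (x : nat -> H1) (y : nat -> H2) : Prop :=
  [/\ proj_dom Phi (x 0%N), edom g (y 0%N) &
    forall k : nat,
      prox (fun v => (sigma k)%:E * g v)
        (y k + sigma k *:
           ((1 + theta k) *: grad2 ip2 Phi (x k) (y k)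
            - theta k *: grad2 ip2 Phi (x k.-1) (y k.-1)))%R
        (y k.+1) /\
      prox (fun u => (tau k)%:E * objective Phi g u (y k.+1))
        (x k) (x k.+1)].

Definition ergodic_weight (R : realType) (theta : nat -> R) (k : nat) : R :=
  (theta 0%N / \prod_(0 <= i < k.+1) theta i)%R.

(* Meaningful for [k >= 1]. *)
Definition ergodic_average (R : realType) (V : lmodType R) (theta : nat -> R)
    (z : nat -> V) (k : nat) : V :=
  ((\sum_(0 <= i < k) ergodic_weight theta i)^-1 *:
     \sum_(0 <= j < k) ergodic_weight theta j *: z j.+1)%R.

(* Main.v *)
(** Adding the three-point inequalities of the two proximal steps to the gradient
    inequality of the concave function [Phi (x (k.+1))] bounds the gap
    f(x_{k+1}, v) - f(u, y_{k+1}) by terms that telescope once multiplied by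
    the weight [t k = ergodic_weight theta k]: indeed tau_k = t_k tau_0,
    sigma_k = sigma_0 / t_k and t_{k+1}^2 = t_k^2 + nu sigma_0 t_k. The
    cross terms coming from the extrapolated gradient are absorbed by Young's
    inequality and the step-size condition. Jensen's inequality turns the weighted
    sum of gaps into the gap at the ergodic averages, divided by the sum of the
    weights, and t_k >= k nu sigma_0 / 3 makes that sum grow like k^2. *)

Require Import Defs.
From HB Require Import structures.
From mathcomp Require Import all_boot all_order all_algebra sesquilinear.
From mathcomp Require Import all_classical all_reals all_analysis.
From mathcomp Require Import ring lra.

Set Implicit Arguments.
Unset Strict Implicit.
Unset Printing Implicit Defensive.

Import Order.TTheory GRing.Theory Num.Theory.
Import numFieldNormedType.Exports.

Local Open Scope classical_set_scope.
Local Open Scope ring_scope.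

(** * Inner products, Riesz representation, gradients and proximal points *)

Section InnerProduct.
Context {R : realType} {H : completeNormedModType R}.
Variable ip : {dot H for idfun}.
Hypothesis hip : hilbert_inner ip.
Implicit Types (a b c u v : H) (k t : R).

Lemma ipC a b : ip a b = ip b a.
Proof. by rewrite hermC expr0 mul1r. Qed.

Lemma ipDl a b c : ip (a + b) c = ip a c + ip b c.
Proof. by rewrite linearDl. Qed.

Lemma ipZl k a b : ip (k *: a) b = k * ip a b.
Proof. by rewrite linearZl_LR. Qed.

Lemma ipNl a b : ip (- a) b = - ip a b.
Proof. by rewrite -scaleN1r ipZl mulN1r. Qed.

Lemma ipDr a b c : ip a (b + c) = ip a b + ip a c.
Proof. by rewrite ipC ipDl !(ipC a). Qed.

Lemma ipZr k a b : ip a (k *: b) = k * ip a b.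
Proof. by rewrite ipC ipZl (ipC a). Qed.

Lemma ipNr a b : ip a (- b) = - ip a b.
Proof. by rewrite ipC ipNl (ipC a). Qed.

Definition ipE := (ipDl, ipDr, ipZl, ipZr, ipNl, ipNr).

Lemma sqr_normD a b : `|a + b| ^+ 2 = `|a| ^+ 2 + 2 * ip a b + `|b| ^+ 2.
Proof. by rewrite -!hip !ipE (ipC b a); ring. Qed.

Lemma sqr_normB a b : `|a - b| ^+ 2 = `|a| ^+ 2 - 2 * ip a b + `|b| ^+ 2.
Proof. by rewrite sqr_normD ipNr normrN; ring. Qed.

(** Expanding the squared norms of [|b| a + |a| b] and [|b| a - |a| b] gives the two bounds, after
    division by [|a| |b|]. *)
Lemma cauchy_schwarz a b : `|ip a b| <= `|a| * `|b|.
Proof.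
have key k l : 0 <= `|k *: a + l *: b| ^+ 2 by apply: exprn_ge0.
have h1 := key `|b| `|a|; have h2 := key `|b| (- `|a|).
move: h1 h2; rewrite !sqr_normD !normrZ !ipE !normrN !normr_id => h1 h2.
have [->|a0] := eqVneq a 0; first by rewrite -(scale0r 0) ipZl mul0r scale0r !normr0 mul0r.
have [->|b0] := eqVneq b 0; first by rewrite -(scale0r 0) ipZr mul0r scale0r !normr0 mulr0.
have pa : 0 < `|a| by rewrite normr_gt0.
have pb : 0 < `|b| by rewrite normr_gt0.
have pab := mulr_gt0 pa pb.
rewrite ler_norml; apply/andP; split.
  rewrite -subr_ge0 -(pmulr_rge0 _ pab); nra.
rewrite -subr_ge0 -(pmulr_rge0 _ pab); nra.
Qed.

Lemma sqr_norm_convex a b c t :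
  `|c - (t *: a + (1 - t) *: b)| ^+ 2
  = t * `|c - a| ^+ 2 + (1 - t) * `|c - b| ^+ 2 - t * (1 - t) * `|a - b| ^+ 2.
Proof.
rewrite -!hip !ipE (ipC a c) (ipC b c) (ipC b a); ring.
Qed.

(* The representative of [L] maximizes [Q u = L u - |u|^2 / 2]: maximizing
   sequences are Cauchy by the parallelogram law. *)
Lemma riesz (L : {linear H -> R^o}) : continuous L ->
  exists v, forall h, L h = ip v h.
Proof.
move=> cL.
have LD a b : L (a + b) = (L a : R) + L b by rewrite linearD.
have LZ k a : L (k *: a) = k * (L a : R) by rewrite linearZ.
pose Q u : R := L u - 2^-1 * `|u| ^+ 2.
have [M M0 LM] : exists2 M : R, 0 <= M & forall u, L u <= M * `|u|.
  have /linear_boundedP [M [Mr hM]] : bounded_near L (nbhs (0 : H)).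
    by apply: continuous_linear_bounded; exact: cL.
  exists (`|M| + 1); first by rewrite addr_ge0.
  move=> u; apply: le_trans (ler_norm _) _; apply: hM.
  by apply: le_lt_trans (ler_norm _) _; rewrite ltrDl.
have QM u : Q u <= M ^+ 2 / 2.
  have := sqr_ge0 (M - `|u|); have := LM u; rewrite /Q; nra.
pose S := sup (range Q).
have hS : has_sup (range Q).
  by split; [exists (Q 0), 0|exists (M ^+ 2 / 2) => _ [u _ <-]].
have QS u : Q u <= S by apply: (ub_le_sup hS.2); exists u.
have /choice [u hu] : forall n : nat, exists u, S - n.+1%:R^-1 < Q u.
  move=> n; have [|_ [u _ <-] ?] := @sup_adherent _ (range Q) n.+1%:R^-1 _ hS; last by exists u.
  by rewrite invr_gt0.
have par a b : `|a - b| ^+ 2 <= 4 * ((S - Q a) + (S - Q b)).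
  have := QS (2^-1 *: (a + b)); rewrite /Q LZ LD normrZ exprMn sqr_normB sqr_normD.
  by rewrite ger0_norm // => h; lra.
have /cauchy_cvg cu : cauchy (u @ \oo).
  apply: cauchy_exP => e e0.
  have [N _ hN] : \forall n \near \oo, n.+1%:R^-1 < e ^+ 2 / 8.
    by apply: (near_infty_natSinv_lt (PosNum (_ : 0 < e ^+ 2 / 8))); rewrite divr_gt0 ?exprn_gt0.
  exists (u N); exists N => // n /= Nn.
  rewrite -ball_normE /=.
  have h1 := hN N (leqnn N); have h2 := hN n Nn.
  have := par (u N) (u n); have := hu N; have := hu n => k1 k2 k3.
  rewrite -(@ltr_pXn2r _ 2) ?nnegrE //; last exact: ltW.
  move: h1 h2 k1 k2 k3 => /=.
  by move: N.+1%:R^-1 n.+1%:R^-1 => r1 r2 *; lra.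
set v := lim (u @ \oo) in cu.
have Qv : S <= Q v.
  have cQ : (fun n => Q (u n)) @ \oo --> Q v.
    apply: cvgB; first by apply: continuous_cvg => //; exact: cL.
    apply: cvgM; first exact: cvg_cst.
    have cN : (fun n => `|u n|) @ \oo --> `|v| by exact: cvg_norm.
    by rewrite expr2; under eq_fun do rewrite expr2; exact: cvgM.
  have hl : (fun n : nat => S - n.+1%:R^-1) @ \oo --> S - 0.
    by apply: cvgB; [exact: cvg_cst|exact: cvg_harmonic].
  rewrite subr0 in hl; apply: (ler_cvg_to hl cQ).
  by near=> n; exact/ltW/hu.
exists v => h; apply/eqP; rewrite -subr_eq0; apply/negPn/negP => d0.
set d := L h - ip v h in d0.
(* Perturb the maximizer [v] along [h]. A nonzero slope [d] is refuted at [t = d / (|h|^2 + 1)],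
   where the [+ 1] keeps the denominator positive for [h = 0]. *)
have key t : t * d - t ^+ 2 / 2 * `|h| ^+ 2 <= 0.
  have := le_trans (QS (v + t *: h)) Qv; rewrite /Q LD LZ sqr_normD normrZ exprMn.
  rewrite real_normK ?num_real // ipZr /d => ?; lra.
have h0 : 0 <= `|h| ^+ 2 by apply: exprn_ge0.
have p : 0 < `|h| ^+ 2 + 1 by lra.
have := key (d / (`|h| ^+ 2 + 1)).
have -> : d / (`|h| ^+ 2 + 1) * d - (d / (`|h| ^+ 2 + 1)) ^+ 2 / 2 * `|h| ^+ 2
  = d ^+ 2 / (`|h| ^+ 2 + 1) ^+ 2 * (`|h| ^+ 2 / 2 + 1).
  by field; rewrite gt_eqF.
apply/negP; rewrite -ltNge; apply: mulr_gt0; last lra.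
by apply: divr_gt0; [rewrite exprn_even_gt0|exact: exprn_gt0].
Unshelve. all: by end_near. Qed.

(** The [get] in [gradient] is a default value unless a representative exists; [riesz] provides one,
    the differential being continuous. *)
Lemma gradientE (F : H -> R^o) y : differentiable F y ->
  forall h, 'd F y h = ip (gradient ip F y) h.
Proof.
move=> dF; rewrite /gradient.
have [v hv] : exists v, forall h, 'd F y h = ip v h.
  by apply: riesz; exact: diff_continuous.
by move: (getPex (ex_intro _ v hv : exists v, [set v | forall h, 'd F y h = ip v h] v)).
Qed.

(** Concavity bounds the difference quotients from [y] towards [z] below by [F z - F y]; the limit
    from the right keeps this bound. *)
Lemma concave_gradient_le (F : H -> R^o) y z : differentiable F y ->
  (forall t, 0 <= t <= 1 ->
     t * F z + (1 - t) * F y <= F (t *: z + (1 - t) *: y)) ->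
  F z - F y <= ip (gradient ip F y) (z - y).
Proof.
move=> dF cF; rewrite -gradientE // -deriveE //.
have dr := diff_derivable (v := z - y) dF.
have hd : (fun h => h^-1 *: ((F \o shift y) (h *: (z - y)) - F y)) @ (0:R)^'+ --> 'D_(z - y) F y.
  by apply: cvg_trans dr; apply: cvg_app; apply: within_subset; move=> t /=; move/gt_eqF => ->.
apply: (cvgr_to_ge hd).
near=> t.
have t0 : 0 < t by [].
rewrite /= /GRing.scale /= mulrC ler_pdivlMr //.
have -> : t *: (z - y) + y = t *: z + (1 - t) *: y.
  by rewrite scalerBr scalerBl scale1r -addrA; congr (_ + _); rewrite addrC.
have /cF : 0 <= t <= 1.
  by rewrite ltW //=; near: t; apply: nbhs_right_le.
lra.
Unshelve. all: by end_near. Qed.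

(* The prox objective is strongly convex with modulus [1 + nu]; compare its
   value at [p] with its values along the segment to [q] and let [t -> 0]. *)
Lemma prox_three_point (h : H -> \bar R) (w p q : H) (nu hp hq : R) :
  prox h w p -> h p = hp%:E -> h q = hq%:E ->
  (forall t, 0 <= t <= 1 ->
    (h (t *: q + (1 - t) *: p)%R
      <= (t * hq + (1 - t) * hp - nu / 2 * (t * (1 - t)) * `|q - p| ^+ 2)%:E)%E) ->
  hp + 2^-1 * `|w - p| ^+ 2 + (1 + nu) / 2 * `|q - p| ^+ 2
    <= hq + 2^-1 * `|w - q| ^+ 2.
Proof.
move=> pr hpE hqE cv.
set A := hp + _; set B := hq + _; set D := _ / 2 * _.
have key t : 0 < t <= 1 -> A + (1 - t) * D <= B.
  move=> /andP[t0 t1].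
  have := pr (t *: q + (1 - t) *: p); rewrite hpE => h1.
  have /cv h2 : 0 <= t <= 1 by rewrite ltW.
  have := le_trans h1 (leeD2r _ h2); rewrite -!EFinD lee_fin sqr_norm_convex => h3.
  rewrite -subr_ge0 -(pmulr_rge0 _ t0) /A /B /D; nra.
(* The limit is made explicit: [t = min(1, e / D)] loses at most [e]. If [D <= 0], then [t = 1]
   suffices. *)
apply/ler_addgt0Pr => e e0.
have [D0|D0] := lerP D 0.
  have := key 1; rewrite ltr01 lexx => /(_ isT); lra.
have := key (Order.min 1 (e / D)).
rewrite lt_min ltr01 divr_gt0 // ge_min lexx => /(_ isT).
have : Order.min 1 (e / D) * D <= e by rewrite -ler_pdivlMr // ge_min lexx orbT.
lra.
Qed.

End InnerProduct.

(** * Step sizes and growth of the ergodic weights *)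

Section StepSizes.
Context {R : realType}.
Variables (theta sigma tau : nat -> R) (nu : R).
Hypotheses (nu_gt0 : 0 < nu) (theta0 : theta 0%N = 1) (sigma0_gt0 : 0 < sigma 0%N).
Hypothesis thetaS : forall k, theta k.+1 = (Num.sqrt (1 + nu * sigma k))^-1.
Hypothesis tauS : forall k, tau k.+1 = tau k / theta k.+1.
Hypothesis sigmaS : forall k, sigma k.+1 = theta k.+1 * sigma k.
Local Notation t := (ergodic_weight theta).
Local Notation a := (nu * sigma 0%N).

Lemma sigma_gt0 k : 0 < sigma k.
Proof.
elim: k => // k IH; rewrite sigmaS thetaS mulr_gt0 // invr_gt0 sqrtr_gt0.
by rewrite ltr_wpDr // mulr_ge0 // ltW.
Qed.

Lemma theta_gt0 k : 0 < theta k.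
Proof.
case: k => [|k]; first by rewrite theta0.
by rewrite thetaS invr_gt0 sqrtr_gt0 ltr_wpDr // mulr_ge0 ?ltW ?sigma_gt0.
Qed.

Lemma theta_le1 k : theta k <= 1.
Proof.
case: k => [|k]; first by rewrite theta0.
rewrite thetaS invf_le1 ?sqrtr_gt0; last first.
  by rewrite ltr_wpDr // mulr_ge0 ?ltW ?sigma_gt0.
by rewrite -[leLHS]sqrtr1 ler_sqrt ?lerDl ?addr_ge0 ?mulr_ge0 ?(ltW nu_gt0) ?ltW ?sigma_gt0.
Qed.

Lemma weight0 : t 0%N = 1.
Proof. by rewrite /ergodic_weight big_nat1 theta0 divr1. Qed.

Lemma weightS k : t k.+1 * theta k.+1 = t k.
Proof.
rewrite /ergodic_weight theta0 !mul1r [X in X^-1 * _]big_nat_recr //= invfM -mulrA.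
by rewrite mulVf ?mulr1 // gt_eqF ?theta_gt0.
Qed.

Lemma weight_ge1 k : 1 <= t k.
Proof.
elim: k => [|k IH]; first by rewrite weight0.
apply: le_trans IH _; rewrite -weightS ler_piMr ?theta_le1 //.
rewrite /ergodic_weight theta0 mul1r invr_ge0 prodr_ge0 // => i _; exact/ltW/theta_gt0.
Qed.

Lemma weight_gt0 k : 0 < t k.
Proof. exact: lt_le_trans (weight_ge1 k). Qed.

Lemma tau_weight k : tau k = t k * tau 0%N.
Proof.
elim: k => [|k IH]; first by rewrite weight0 mul1r.
by rewrite tauS IH -(weightS k); field; rewrite gt_eqF ?theta_gt0.
Qed.

Lemma sigma_weight k : sigma k = sigma 0%N / t k.
Proof.
elim: k => [|k IH]; first by rewrite weight0 divr1.
rewrite sigmaS IH -(weightS k); field.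
by rewrite !gt_eqF ?theta_gt0 ?weight_gt0.
Qed.

(** Since [sigma k * t k] is constant, [t k ^+ 2 * (1 + nu * sigma k)] has this value. Hence the
    distance term left by strong convexity at one step is exactly the one that opens the next. *)
Lemma sqr_weightS k : t k.+1 ^+ 2 = t k ^+ 2 + a * t k.
Proof.
have s := sigma_gt0 k.
have p : 0 < 1 + nu * sigma k by rewrite ltr_wpDr // mulr_ge0 ?ltW.
have -> : t k.+1 = t k * Num.sqrt (1 + nu * sigma k).
  by rewrite -(weightS k) thetaS mulfVK // gt_eqF // sqrtr_gt0.
rewrite exprMn sqr_sqrtr ?ltW // sigma_weight.
by field; rewrite gt_eqF ?weight_gt0.
Qed.

Hypothesis sigma0_le : sigma 0%N <= (9 + 3 * Num.sqrt 13) / (2 * nu).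

Let a_gt0 : 0 < a. Proof. exact: mulr_gt0. Qed.

(** The bound on [a] is the positive root of [u^2 - 9 u - 9]. Divided by 9, the inequality reads
    [(a / 3)^2 <= 1 + a], and [1 + a] is the square of [t 1]. *)
Lemma sqr_nu_sigma0_le : a ^+ 2 <= 9 + 9 * a.
Proof.
have h : 2 * a - 9 <= 3 * Num.sqrt 13.
  by move: sigma0_le; rewrite ler_pdivlMr ?mulr_gt0 // => ?; lra.
have s0 : 0 <= Num.sqrt (13 : R) by [].
have s2 : Num.sqrt (13 : R) ^+ 2 = 13 by rewrite sqr_sqrtr.
move: a_gt0 h; move: a => u u0 h; have [l|l] := lerP (2 * u - 9) 0; first by nra.
have : (2 * u - 9) ^+ 2 <= (3 * Num.sqrt 13) ^+ 2.
  by rewrite lerXn2r // ?nnegrE ?mulr_ge0 // ltW.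
rewrite exprMn s2; nra.
Qed.

(* The bound on [sigma 0] is what makes [a / 3 <= t 1], from which point on
   the increments of the weights are at least [a / 3]. *)
Lemma weight_ge k : k%:R * (a / 3) <= t k.
Proof.
have ha := a_gt0.
(* After squaring, the claim is [2 a t / 3 + a^2 / 9 <= a t] with [t = t j], which amounts to
   [a / 3 <= t]. *)
have inc j : a / 3 <= t j -> t j + a / 3 <= t j.+1.
  move=> h; have tj := weight_gt0 j.
  rewrite -(@ler_pXn2r _ 2) ?nnegrE ?(ltW (weight_gt0 _)) //; last first.
    by apply: addr_ge0; lra.
  by rewrite sqr_weightS; move: a_gt0 h tj; move: a (t j) => u v *; nra.
case: k => [|k]; first by rewrite mul0r ltW ?weight_gt0.
have t1 : a / 3 <= t 1%N.
  rewrite -(@ler_pXn2r _ 2) ?nnegrE ?(ltW (weight_gt0 _)) //; last lra.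
  by rewrite sqr_weightS weight0; have := sqr_nu_sigma0_le; lra.
elim: k => [|k IH]; first by rewrite mul1r.
have IH' : a / 3 <= t k.+1 by apply: le_trans IH; rewrite ler_peMl ?ler1n //; lra.
by rewrite -natr1 mulrDl mul1r; apply: le_trans (inc _ IH'); rewrite lerD2r.
Qed.

Lemma sum_weight_ge k : (0 < k)%N ->
  a * k%:R ^+ 2 / 12 <= \sum_(0 <= i < k) t i.
Proof.
case: k => // k _.
(* The 1 is [t 0], the rest sums [i * (a / 3)]. Passing to [a (k+1)^2 / 12] is elementary for
   [k >= 1]; for [k = 0] it needs [a <= 12], a consequence of [sqr_nu_sigma0_le]. *)
suff : 1 + (k%:R * (k%:R + 1)) * (a / 6) <= \sum_(0 <= i < k.+1) t i.
  apply: le_trans; have := sqr_nu_sigma0_le.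
  move: a_gt0; move: a => u u0 u2; case: k => [|k]; first by nra.
  have : 0 <= u * k%:R * (k%:R + 2) by rewrite !mulr_ge0 ?addr_ge0 // ltW.
  by rewrite -[k.+2%:R]natr1 -[k.+1%:R]natr1; move: (k%:R) => v *; lra.
elim: k => [|k IH]; first by rewrite big_nat1 weight0; lra.
rewrite big_nat_recr //=; have := weight_ge k.+1.
by rewrite -[k.+1%:R]natr1 => h; lra.
Qed.

End StepSizes.

(** * Summation of the one-step inequality, as a statement on real sequences *)

Section Energy.
Context {R : realFieldType}.
(** For gradient increments [q k] and a comparison point [(u, v)], these will be:
    [A k = <q k, y k - v>], [B k = <q k, y (k+1) - y k>], [X k = |u - x k|^2], [e k = |v - y k|],
    while [a k] and [b k] are the lengths of the last moves of [x] and [y]. *)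
Variables (t th A B X e gap a b : nat -> R) (L M c s0 tau0 : R).
Hypotheses (L_ge0 : 0 <= L) (M_ge0 : 0 <= M) (Lc : L < c)
  (s0_gt0 : 0 < s0) (tau0_gt0 : 0 < tau0).
Hypotheses (t_ge1 : forall k, 1 <= t k) (th0 : forall k, 0 <= th k)
  (th1 : forall k, th k <= 1) (tS : forall k, t k.+1 * th k.+1 = t k).
Hypotheses (A0 : A 0%N = 0) (a0 : a 0%N = 0) (b0 : b 0%N = 0) (b_ge0 : forall k, 0 <= b k).
Hypothesis small_step : (c * L * tau0 + 2 * M) * s0 <= 1.
Hypothesis B_le : forall k, B k <= (L * a k + M * b k) * b k.+1.
Hypothesis A_ge : forall k, - A k <= (L * a k + M * b k) * e k.
Hypothesis step : forall k, t k * gap k <=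
  t k * th k * A k - t k * A k.+1 + t k * th k * B k
  + (X k - X k.+1 - a k.+1 ^+ 2) / (2 * tau0)
  + t k ^+ 2 / (2 * s0) * (e k ^+ 2 - b k.+1 ^+ 2)
  - t k.+1 ^+ 2 / (2 * s0) * e k.+1 ^+ 2.

(* The energy retained from step [k] to pay for its cross terms, which
   appear only at step [k.+1]. *)
Let rest k := L / (2 * c * tau0) * a k ^+ 2 + t k * th k * M / 2 * b k ^+ 2.

Let c_gt0 : 0 < c. Proof. exact: le_lt_trans Lc. Qed.

(** Young's inequality for each product, then [th k <= 1]. The weight [c * tau0] makes the
    coefficient of [a k ^+ 2] at most [1 / (2 tau0)], because [L < c]. *)
Let cross_le k d : t k * th k * ((L * a k + M * b k) * d) <=
  rest k + (c * L * tau0 * t k ^+ 2 + t k * th k * M) / 2 * d ^+ 2.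
Proof.
rewrite /rest; set s := t k * th k.
have tk0 : 0 <= t k by exact: le_trans (t_ge1 k).
have s_ge0 : 0 <= s by rewrite mulr_ge0.
have s_le : s ^+ 2 <= t k ^+ 2 by rewrite lerXn2r ?nnegrE // ler_piMr.
have h1 : 0 <= L / (2 * c * tau0) * (a k - c * tau0 * s * d) ^+ 2.
  by rewrite mulr_ge0 ?sqr_ge0 // divr_ge0 // !mulr_ge0 // ltW.
have h2 : 0 <= s * M / 2 * (b k - d) ^+ 2 by rewrite mulr_ge0 ?sqr_ge0 // !mulr_ge0.
have h3 : 0 <= (t k ^+ 2 - s ^+ 2) * (c * L * tau0) / 2 * d ^+ 2.
  by rewrite mulr_ge0 ?sqr_ge0 // divr_ge0 // mulr_ge0 ?subr_ge0 // !mulr_ge0 // ltW.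
rewrite -subr_ge0; apply: le_trans (addr_ge0 (addr_ge0 h1 h2) h3) _.
rewrite le_eqVlt; apply/orP; left; apply/eqP; field.
by rewrite !gt_eqF.
Qed.

(** The left side is all that is charged to [b k.+1 ^+ 2]: the share from [cross_le] and the share
    stored in [rest k.+1]. As [t k >= 1], every term is dominated by a multiple of [t k ^+ 2], which
    [small_step] can then compare with [t k ^+ 2 / (2 * s0)]. *)
Let coef_le k : (c * L * tau0 * t k ^+ 2 + t k * th k * M) / 2 + t k * M / 2
  <= (c * L * tau0 + 2 * M) * s0 * (t k ^+ 2 / (2 * s0)).
Proof.
have -> : (c * L * tau0 + 2 * M) * s0 * (t k ^+ 2 / (2 * s0))
  = (c * L * tau0 * t k ^+ 2 + 2 * M * t k ^+ 2) / 2 by field; rewrite gt_eqF.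
have tk1 := t_ge1 k.
have h1 : t k * M <= t k ^+ 2 * M by rewrite ler_wpM2r // expr2 ler_peMl // (le_trans ler01).
have h2 : t k * th k * M <= t k * M.
  by rewrite ler_wpM2r // ler_piMr // (le_trans ler01).
lra.
Qed.

Lemma energy_sum_le K : \sum_(0 <= k < K) t k * gap k <=
  X 0%N / (2 * tau0) + t 0%N ^+ 2 * e 0%N ^+ 2 / (2 * s0) - X K / (2 * tau0)
  - (1 - (c * L * tau0 + 2 * M) * s0) * (t K ^+ 2 / (2 * s0)) * e K ^+ 2.
Proof.
(* The induction carries the pending cross term [A K] and the reserve [rest K]; both vanish at 0. *)
have main : \sum_(0 <= k < K) t k * gap k + X K / (2 * tau0)
    + t K ^+ 2 / (2 * s0) * e K ^+ 2 + t K * th K * A K + rest K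
    <= X 0%N / (2 * tau0) + t 0%N ^+ 2 * e 0%N ^+ 2 / (2 * s0).
  elim: K => [|k IH]; first by rewrite big_geq // /rest A0 a0 b0; lra.
  apply: le_trans IH; rewrite big_nat_recr //= tS.
  have tk0 : 0 <= t k by exact: le_trans (t_ge1 k).
  have p : 0 <= t k * th k by rewrite mulr_ge0.
  have h1 := ler_wpM2l p (B_le k).
  have h2 := cross_le k (b k.+1).
  have h3 : rest k.+1 <= a k.+1 ^+ 2 / (2 * tau0) + t k * M / 2 * b k.+1 ^+ 2.
    rewrite /rest tS lerD2r mulrC ler_wpM2l ?sqr_ge0 //.
    rewrite ler_pdivrMr ?mulr_gt0 // (_ : _ * (_ * c * _) = c) ?ltW //.
    by field; rewrite gt_eqF.
  have h4 := ler_wpM2r (sqr_ge0 (b k.+1)) (coef_le k).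
  have h5 : (c * L * tau0 + 2 * M) * s0 * (t k ^+ 2 / (2 * s0)) * b k.+1 ^+ 2
      <= t k ^+ 2 / (2 * s0) * b k.+1 ^+ 2.
    by rewrite ler_wpM2r ?sqr_ge0 // ler_piMl // divr_ge0 ?sqr_ge0 // mulr_ge0 // ltW.
  have := step k; lra.
(* The last [A K] has no successor to cancel it. It is paid by [rest K] and by a fraction of the
   [e K ^+ 2] term, whence the factor [1 - (c * L * tau0 + 2 * M) * s0]. *)
have tK0 : 0 <= t K by exact: le_trans (t_ge1 K).
have p : 0 <= t K * th K by rewrite mulr_ge0.
have h1 := ler_wpM2l p (A_ge K).
have h2 := cross_le K (e K).
have h3 := ler_wpM2r (sqr_ge0 (e K)) (coef_le K).
have h4 : 0 <= t K * M / 2 * e K ^+ 2 by rewrite mulr_ge0 ?sqr_ge0 // !mulr_ge0.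
lra.
Qed.

End Energy.

(** * Weighted averages and Jensen's inequality on a convex set *)

Section WeightedAverage.
Context {R : realFieldType} {V : lmodType R}.
Variables (D : set V) (w : nat -> R) (z : nat -> V).
Hypothesis convD : forall u v s, D u -> D v -> 0 <= s <= 1 -> D (s *: u + (1 - s) *: v).
Hypotheses (w_gt0 : forall k, 0 < w k) (Dz : forall k, D (z k)).
Local Notation W k := (\sum_(0 <= i < k) w i).
Local Notation avg k := ((W k)^-1 *: \sum_(0 <= j < k) w j *: z j).

Let W_gt0 k : 0 < W k.+1.
Proof. by rewrite big_nat_recr //= ltr_wpDl ?sumr_ge0 // => i _; exact: ltW. Qed.

Let ratio k : 0 <= W k.+1 / W k.+2 <= 1.
Proof.
apply/andP; split; first by apply: divr_ge0; exact: ltW.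
by rewrite ler_pdivrMr // mul1r [leRHS]big_nat_recr //= lerDl ltW.
Qed.

(** Each average is a two-point convex combination of the previous one and the new point, so binary
    convexity is enough for the inductions below. *)
Let avgS k : avg k.+2 = (W k.+1 / W k.+2) *: avg k.+1 + (1 - W k.+1 / W k.+2) *: z k.+1.
Proof.
have W0 : W k.+2 != 0 by rewrite gt_eqF.
have -> : 1 - W k.+1 / W k.+2 = (W k.+2)^-1 * w k.+1.
  rewrite -[X in X - _](divff W0) -mulrBl mulrC; congr (_ * _).
  by rewrite big_nat_recr //= addrAC subrr add0r.
rewrite [X in _ *: X]big_nat_recr //= scalerDr scalerA; congr (_ + _).
  by rewrite scalerA mulrAC divff ?mul1r // gt_eqF.
Qed.

Lemma average_in k : D (avg k.+1).
Proof.
elim: k => [|k IH]; first by rewrite !big_nat1 scalerA mulVf ?scale1r // gt_eqF.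
by rewrite avgS; apply: convD.
Qed.

(** Convexity is asked on [D] only, since the finite part of an extended-valued function may fail to
    be convex off its domain. *)
Lemma jensen_average (F : V -> R) (k : nat) :
  (forall u v s, D u -> D v -> 0 <= s <= 1 ->
     F (s *: u + (1 - s) *: v) <= s * F u + (1 - s) * F v) ->
  W k.+1 * F (avg k.+1) <= \sum_(0 <= j < k.+1) w j * F (z j).
Proof.
move=> cF; elim: k => [|k IH].
  by rewrite !big_nat1 scalerA mulVf ?scale1r // gt_eqF.
have h := cF _ _ _ (average_in k) (Dz k.+1) (ratio k); rewrite -avgS in h.
apply: le_trans (ler_wpM2l (ltW (W_gt0 k.+1)) h) _.
have hW : W k.+2 = W k.+1 + w k.+1 by rewrite big_nat_recr.
rewrite [leRHS]big_nat_recr //= (_ : W k.+2 * _ = W k.+1 * F (avg k.+1) + w k.+1 * F (z k.+1)).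
  exact: lerD.
by have := gt_eqF (W_gt0 k.+1); rewrite hW => W0; field; rewrite W0.
Qed.

End WeightedAverage.

Lemma bounded_funW {R : realType} {V : normedModType R} (u : nat -> V) (M : R) :
  (forall k, `|u k| <= M) -> bounded_fun u.
Proof.
move=> h; exists M; split; first exact: num_real.
by move=> N MN k _; exact: le_trans (h k) (ltW MN).
Qed.

(** [fine] sends both infinities to 0, so this value is faithful only where [h] is finite. *)
Definition finite_part {R : realType} {T : Type} (h : T -> \bar R) (z : T) : R :=
  fine (h z).

(** * Finiteness, convexity and proximal inequalities for the saddle problem *)

Section Problem.
Context {R : realType} {H1 H2 : completeNormedModType R}.
Variables (ip1 : {dot H1 for idfun}) (ip2 : {dot H2 for idfun}).
Hypotheses (hH1 : hilbert_inner ip1) (hH2 : hilbert_inner ip2).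
Variables (Phi : H1 -> H2 -> \bar R) (g : H2 -> \bar R) (nu Lyx Lyy : R).
Hypothesis hsa : standing_assumptions ip2 Phi g nu Lyx Lyy.

Local Notation P := (proj_dom Phi).
Local Notation phi x y := (finite_part (Phi x) y).
Local Notation gam y := (finite_part g y).

Lemma PhiE x y : P x -> Phi x y = (phi x y)%:E.
Proof.
move=> Px; rewrite /finite_part fineK // fin_numE (sa_Phi_gtNy hsa) /=.
rewrite -ltey; have := sa_Phi_dom hsa Px => /seteqP[_ /(_ y)]; exact.
Qed.

Lemma gE y : edom g y -> g y = (gam y)%:E.
Proof. by move=> gy; rewrite /finite_part fineK // fin_numE (sa_g_proper hsa).1 -ltey. Qed.

Lemma objectiveE x y : P x -> edom g y -> objective Phi g x y = (phi x y - gam y)%:E.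
Proof. by move=> Px gy; rewrite /objective PhiE // gE. Qed.

(** Moving the quadratic terms of [g - nu / 2 |.|^2] to one side leaves the defect computed by
    [sqr_norm_convex] with centre 0. *)
Lemma g_convex y y' (s : R) : edom g y -> edom g y' -> 0 <= s <= 1 ->
  (g (s *: y + (1 - s) *: y')%R
    <= (s * gam y + (1 - s) * gam y' - nu / 2 * (s * (1 - s)) * `|y - y'| ^+ 2)%:E)%E.
Proof.
move=> gy gy' s01; have := sa_g_convex hsa y y' s01 => /=.
have := sqr_norm_convex hH2 y y' 0 s.
rewrite !sub0r !normrN => ->; rewrite (gE gy) (gE gy').
case: (g (s *: y + (1 - s) *: y')%R) => [r||] //=; rewrite -?EFinD -?EFinM ?lee_fin //.
  by move=> h; lra.
by move=> _; exact: leNye.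
Qed.

Lemma edom_convex y y' (s : R) : edom g y -> edom g y' -> 0 <= s <= 1 ->
  edom g (s *: y + (1 - s) *: y').
Proof. by move=> gy gy' s01; apply: le_lt_trans (g_convex gy gy' s01) _; rewrite ltry. Qed.

Lemma gam_convex y y' (s : R) : edom g y -> edom g y' -> 0 <= s <= 1 ->
  gam (s *: y + (1 - s) *: y') <= s * gam y + (1 - s) * gam y'.
Proof.
move=> gy gy' s01; have := g_convex gy gy' s01.
rewrite gE ?lee_fin; last exact: edom_convex.
move=> /le_trans; apply; rewrite gerBl mulr_ge0 ?sqr_ge0 // mulr_ge0 ?divr_ge0 ?(sa_nu_ge0 hsa) //.
by case/andP: s01 => s0 s1; rewrite mulr_ge0 // subr_ge0.
Qed.

Lemma Phi_convex x x' y (s : R) : P x -> P x' -> edom g y -> 0 <= s <= 1 ->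
  (Phi (s *: x + (1 - s) *: x')%R y <= (s * phi x y + (1 - s) * phi x' y)%:E)%E.
Proof.
move=> Px Px' gy s01; have := sa_Phi_convex hsa gy x x' s01.
by rewrite (PhiE y Px) (PhiE y Px').
Qed.

(** For a fixed [y] in [edom g], points of [P] give finite values of [Phi ^~ y], and convexity keeps
    the value finite on the segment. *)
Lemma proj_dom_convex x x' (s : R) : P x -> P x' -> 0 <= s <= 1 -> P (s *: x + (1 - s) *: x').
Proof.
move=> Px Px' s01; have [y gy] := (sa_g_proper hsa).2.
by exists y; apply: le_lt_trans (Phi_convex Px Px' gy s01) _; rewrite ltry.
Qed.

Lemma phi_convex x x' y (s : R) : P x -> P x' -> edom g y -> 0 <= s <= 1 ->
  phi (s *: x + (1 - s) *: x') y <= s * phi x y + (1 - s) * phi x' y.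
Proof.
move=> Px Px' gy s01; have := Phi_convex Px Px' gy s01.
by rewrite PhiE ?lee_fin //; exact: proj_dom_convex.
Qed.

Lemma phi_concave x y y' (s : R) : P x -> 0 <= s <= 1 ->
  s * phi x y + (1 - s) * phi x y' <= phi x (s *: y + (1 - s) *: y').
Proof.
move=> Px s01; have := sa_Phi_concave hsa Px y y' s01.
by rewrite !(PhiE _ Px) -!EFinN -!EFinM -EFinD lee_fin => h; lra.
Qed.

(** If [g ys] were infinite, a point of [P] would give [f] the value -oo at [ys], below
    [f xs y1 > -oo]. If [xs] were outside [P], then [f xs ys] would be +oo, above a finite value. *)
Lemma saddle_point_dom xs ys : saddle_point (objective Phi g) xs ys -> P xs /\ edom g ys.
Proof.
move=> sad; have [x0 [y0 Pxy0]] := sa_dom_Phi hsa.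
have Px0 : P x0 by exists y0.
have gN y : g y != -oo%E by exact: (sa_g_proper hsa).1.
have [y1 gy1] := (sa_g_proper hsa).2.
have gys : edom g ys.
  rewrite /edom /= ltey; apply/eqP => gys.
  have [h1 h2] := sad x0 y1.
  have : (objective Phi g xs y1 <= objective Phi g x0 ys)%E by exact: le_trans h1 h2.
  rewrite /objective (PhiE _ Px0) gys (gE gy1) /=.
  have := sa_Phi_gtNy hsa xs y1; by case: (Phi xs y1).
split=> //; apply: contrapT => nP.
have [_ h2] := sad x0 ys; move: h2.
rewrite (objectiveE Px0 gys) /objective (gE gys).
have -> : Phi xs ys = +oo%E.
  by apply/eqP; rewrite -leye_eq leNgt; apply/negP => h; apply: nP; exists ys.
by [].
Qed.

Lemma prox_g_dom (w p : H2) (s : R) : 0 < s ->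
  prox (fun v => s%:E * g v)%E w p -> edom g p.
Proof.
move=> s0 pr; have [y1 gy1] := (sa_g_proper hsa).2.
have := pr y1; rewrite (gE gy1) /edom /=.
case: (g p) => [r _|/=|_]; rewrite ?ltry ?ltNyr // gt0_muley ?lte_fin //.
Qed.

Lemma prox_g_le (w p q : H2) (s : R) : 0 < s -> edom g q ->
  prox (fun v => s%:E * g v)%E w p ->
  s * gam p + 2^-1 * `|w - p| ^+ 2 + (1 + s * nu) / 2 * `|q - p| ^+ 2
    <= s * gam q + 2^-1 * `|w - q| ^+ 2.
Proof.
move=> s0 gq pr; have gp := prox_g_dom s0 pr.
apply: (prox_three_point hH2 pr); rewrite ?gE //.
move=> r r01; rewrite (gE (edom_convex gq gp r01)) -EFinM lee_fin.
have := g_convex gq gp r01; rewrite (gE (edom_convex gq gp r01)) lee_fin => h.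
have := ler_wpM2l (ltW s0) h; lra.
Qed.

Lemma prox_Phi_dom (x p : H1) y (s : R) : 0 < s -> edom g y ->
  prox (fun u => s%:E * objective Phi g u y)%E x p -> P p.
Proof.
move=> s0 gy pr; have [x0 [y0 Pxy0]] := sa_dom_Phi hsa.
have Px0 : P x0 by exists y0.
exists y; have := pr x0; rewrite (objectiveE Px0 gy) /objective (gE gy).
by case: (Phi p y) => [r _|/=|_]; rewrite ?ltry ?ltNyr // gt0_muley ?lte_fin.
Qed.

Lemma prox_Phi_le (x p q : H1) y (s : R) : 0 < s -> edom g y -> P q ->
  prox (fun u => s%:E * objective Phi g u y)%E x p ->
  s * phi p y + 2^-1 * `|x - p| ^+ 2 + 2^-1 * `|q - p| ^+ 2
    <= s * phi q y + 2^-1 * `|x - q| ^+ 2.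
Proof.
move=> s0 gy Pq pr; have Pp := prox_Phi_dom s0 gy pr.
(* The modulus is 0, as [Phi ^~ y] is merely convex; the constant [gam y] cancels. *)
have := @prox_three_point _ _ ip1 hH1 _ x p q 0 (s * (phi p y - gam y)) (s * (phi q y - gam y)) pr.
rewrite !objectiveE // => /(_ erefl erefl) h.
suff : s * (phi p y - gam y) + 2^-1 * `|x - p| ^+ 2 + (1 + 0) / 2 * `|q - p| ^+ 2
    <= s * (phi q y - gam y) + 2^-1 * `|x - q| ^+ 2 by lra.
apply: h => r r01; rewrite (objectiveE (proj_dom_convex Pq Pp r01) gy) -EFinM lee_fin.
have := ler_wpM2l (ltW s0) (phi_convex Pq Pp gy r01); lra.
Qed.

(** * The one-step gap estimate *)

Section Iterates.
Variables (sigma tau theta : nat -> R) (x : nat -> H1) (y : nat -> H2).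
Hypotheses (sigma_gt0 : forall k, 0 < sigma k) (tau_gt0 : forall k, 0 < tau k).
Hypothesis halg : OGAProx ip2 Phi g sigma tau theta x y.

Lemma iterate_dom k : P (x k) /\ edom g (y k).
Proof.
case: halg => Px0 gy0 it; case: k => // k; have [py px] := it k.
have gy := prox_g_dom (sigma_gt0 k) py; split=> //.
exact: prox_Phi_dom px.
Qed.

Let G k := grad2 ip2 Phi (x k) (y k).
(** [q 0] is zero because [0.-1 = 0]: the first step has no extrapolation. *)
Let q k := G k - G k.-1.

Lemma grad_increment_le k (h : H2) : `|ip2 (q k) h|
  <= (Lyx * `|x k - x k.-1| + Lyy * `|y k - y k.-1|) * `|h|.
Proof.
apply: le_trans (cauchy_schwarz hH2 _ _) _; rewrite ler_wpM2r //.
by have [? ?] := iterate_dom k; have [? ?] := iterate_dom k.-1; apply: (sa_grad_lipschitz hsa).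
Qed.

(* The extrapolated gradient is [G k + theta k *: q k], so that the gradient
   terms of the prox and concavity inequalities nearly telescope. *)
Lemma gap_le k u v : P u -> edom g v ->
  phi (x k.+1) v - gam v - (phi u (y k.+1) - gam (y k.+1)) <=
  theta k * ip2 (q k) (y k - v) - ip2 (q k.+1) (y k.+1 - v)
  + theta k * ip2 (q k) (y k.+1 - y k)
  + (`|u - x k| ^+ 2 - `|u - x k.+1| ^+ 2 - `|x k.+1 - x k| ^+ 2) / (2 * tau k)
  + (`|v - y k| ^+ 2 - `|y k.+1 - y k| ^+ 2
     - (1 + nu * sigma k) * `|v - y k.+1| ^+ 2) / (2 * sigma k).
Proof.
move=> Pu gv; have [Px gy] := iterate_dom k.+1.
have [_ _ /(_ k) [py px]] := halg.
have h1 : phi (x k.+1) v - phi (x k.+1) (y k.+1) <= ip2 (G k.+1) (v - y k.+1).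
  apply: (concave_gradient_le hH2); first exact: (sa_Phi_diff hsa).
  by move=> t t01; exact: phi_concave.
have s0 := sigma_gt0 k; have t0 := tau_gt0 k.
have h2 : phi (x k.+1) (y k.+1) - phi u (y k.+1)
    <= (`|u - x k| ^+ 2 - `|u - x k.+1| ^+ 2 - `|x k.+1 - x k| ^+ 2) / (2 * tau k).
  have := prox_Phi_le t0 gy Pu px; rewrite ler_pdivlMr ?mulr_gt0 //.
  rewrite (distrC (x k) u) (distrC (x k)); lra.
have h3 : gam (y k.+1) - gam v <= ip2 (G k + theta k *: q k) (y k.+1 - v)
   + (`|v - y k| ^+ 2 - `|y k.+1 - y k| ^+ 2
     - (1 + nu * sigma k) * `|v - y k.+1| ^+ 2) / (2 * sigma k).
  have := prox_g_le s0 gv py.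
  have -> : (1 + theta k) *: grad2 ip2 Phi (x k) (y k)
     - theta k *: grad2 ip2 Phi (x k.-1) (y k.-1) = G k + theta k *: q k.
    by rewrite scalerDl scale1r scalerBr addrA.
  set d := G k + _; move=> h.
  rewrite -lerBlDl ler_pdivlMr ?mulr_gt0 //.
  (* Expanding around [y k] turns the gradient shift into an inner product with [d]; the square of
     [sigma k *: d] occurs on both sides and cancels. *)
  have e z : `|y k + sigma k *: d - z| ^+ 2
      = `|z - y k| ^+ 2 + 2 * sigma k * ip2 d (y k - z) + `|sigma k *: d| ^+ 2.
    by rewrite addrAC (sqr_normD hH2) ipZr (ipC _ (y k - z)) (distrC z) mulrA.
  have -> : ip2 d (y k.+1 - v) = ip2 d (y k - v) - ip2 d (y k - y k.+1).
    by rewrite -ipNr -ipDr; congr (ip2 d _); rewrite opprB [RHS]addrC subrKA.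
  move: h; rewrite (e v) (e (y k.+1)).
  move: (ip2 d _) (ip2 d _) => i1 i2.
  move: (`|v - y k| ^+ 2) (`|v - y k.+1| ^+ 2) (`|y k.+1 - y k| ^+ 2) (`|sigma k *: d| ^+ 2).
  by move=> n1 n2 n3 n4; lra.
(* With [g0], [g1], [g2] the gradients at steps [k-1], [k], [k+1], the gradient terms split into a
   telescoping pair and one product with the move [y (k+1) - y k]. *)
have ipq (g0 g1 g2 z p : H2) (r : R) :
    r * ip2 (g1 - g0) (z - v) - ip2 (g2 - g1) (p - v) + r * ip2 (g1 - g0) (p - z)
    = ip2 g2 (v - p) + ip2 (g1 + r *: (g1 - g0)) (p - v).
  by rewrite !ipE; ring.
rewrite /q /= ipq; lra.
Qed.

End Iterates.

(** * Rate for the ergodic gap, and boundedness *)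

Section Rate.
Hypothesis nu_gt0 : 0 < nu.
Variable c_alpha : R.
Hypothesis hc : Lyx < c_alpha.
Variables (sigma tau theta : nat -> R).
Hypotheses (theta0 : theta 0%N = 1) (tau0_gt0 : 0 < tau 0%N) (sigma0_gt0 : 0 < sigma 0%N).
Hypothesis hstep : (c_alpha * Lyx * tau 0%N + 2 * Lyy) * sigma 0%N < 1.
Hypothesis sigma0_le : sigma 0%N <= (9 + 3 * Num.sqrt 13) / (2 * nu).
Hypothesis thetaS : forall k, theta k.+1 = (Num.sqrt (1 + nu * sigma k))^-1.
Hypothesis tauS : forall k, tau k.+1 = tau k / theta k.+1.
Hypothesis sigmaS : forall k, sigma k.+1 = theta k.+1 * sigma k.
Variables (x : nat -> H1) (y : nat -> H2).
Hypothesis halg : OGAProx ip2 Phi g sigma tau theta x y.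
Local Notation t := (ergodic_weight theta).

Let t_gt0 k : 0 < t k. Proof. exact: (weight_gt0 nu_gt0 theta0 sigma0_gt0). Qed.

Let sigma_pos k : 0 < sigma k.
Proof. exact: (sigma_gt0 nu_gt0 sigma0_gt0 thetaS). Qed.

Let tau_pos k : 0 < tau k.
Proof. by rewrite (tau_weight nu_gt0 theta0 sigma0_gt0 thetaS tauS sigmaS) mulr_gt0. Qed.

Let dom k := iterate_dom sigma_pos tau_pos halg k.

Lemma weighted_gap_le u v K : P u -> edom g v ->
  \sum_(0 <= k < K) t k * (phi (x k.+1) v - gam v - (phi u (y k.+1) - gam (y k.+1))) <=
  `|u - x 0%N| ^+ 2 / (2 * tau 0%N) + `|v - y 0%N| ^+ 2 / (2 * sigma 0%N)
  - `|u - x K| ^+ 2 / (2 * tau 0%N)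
  - (1 - (c_alpha * Lyx * tau 0%N + 2 * Lyy) * sigma 0%N)
    * (t K ^+ 2 / (2 * sigma 0%N)) * `|v - y K| ^+ 2.
Proof.
move=> Pu gv.
pose q k := grad2 ip2 Phi (x k) (y k) - grad2 ip2 Phi (x k.-1) (y k.-1).
have inc := grad_increment_le sigma_pos tau_pos halg.
have := @energy_sum_le R t theta (fun k => ip2 (q k) (y k - v))
  (fun k => ip2 (q k) (y k.+1 - y k)) (fun k => `|u - x k| ^+ 2) (fun k => `|v - y k|)
  (fun k => phi (x k.+1) v - gam v - (phi u (y k.+1) - gam (y k.+1)))
  (fun k => `|x k - x k.-1|) (fun k => `|y k - y k.-1|)
  Lyx Lyy c_alpha (sigma 0%N) (tau 0%N).
rewrite (weight0 theta0) expr1n mul1r; apply=> //.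
- exact: (sa_Lyx_ge0 hsa).
- exact: (sa_Lyy_ge0 hsa).
- exact: (weight_ge1 nu_gt0 theta0 sigma0_gt0).
- by move=> k; exact/ltW/(theta_gt0 nu_gt0 theta0 sigma0_gt0).
- exact: (theta_le1 nu_gt0 theta0 sigma0_gt0).
- exact: (weightS nu_gt0 theta0 sigma0_gt0).
- by rewrite /q subrr -(scale0r 0) ipZl mul0r.
- by rewrite subrr normr0.
- by rewrite subrr normr0.
- exact: ltW.
- by move=> k; apply: le_trans (ler_norm _) (inc k _).
- by move=> k; rewrite -ipNr opprB; apply: le_trans (ler_norm _) (inc k _).
move=> k; apply: le_trans (ler_wpM2l (ltW (t_gt0 k)) (gap_le sigma_pos tau_pos halg k Pu gv)) _.
rewrite (sqr_weightS nu_gt0 theta0 sigma0_gt0 thetaS sigmaS).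
rewrite (tau_weight nu_gt0 theta0 sigma0_gt0 thetaS tauS sigmaS k).
rewrite (sigma_weight nu_gt0 theta0 sigma0_gt0 thetaS sigmaS k) /=.
(* With [r = t k], multiplication makes the denominators of the [x] terms independent of [k] and
   gives the [y] terms the weights [t k ^+ 2] and [t k.+1 ^+ 2]. *)
have scale (r th i1 i2 i3 n1 n2 n3 n4 n5 n6 s0 r0 : R) : 0 < r -> 0 < s0 -> 0 < r0 ->
    r * (th * i1 - i2 + th * i3 + (n1 - n2 - n3) / (2 * (r * r0))
      + (n4 - n5 - (1 + nu * (s0 / r)) * n6) / (2 * (s0 / r)))
    = r * th * i1 - r * i2 + r * th * i3 + (n1 - n2 - n3) / (2 * r0)
      + r ^+ 2 / (2 * s0) * (n4 - n5) - (r ^+ 2 + nu * s0 * r) / (2 * s0) * n6.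
  by move=> p1 p2 p3; field; rewrite !gt_eqF.
by rewrite scale.
Qed.

Local Notation D u v :=
  ((tau 0%N)^-1 * `|u - x 0%N| ^+ 2 + (sigma 0%N)^-1 * `|v - y 0%N| ^+ 2).
Local Notation xhat := (ergodic_average theta x).
Local Notation yhat := (ergodic_average theta y).

Lemma xhat_dom k : P (xhat k.+1).
Proof.
apply: (@average_in _ _ P t (fun k => x k.+1)) => // [u v s|j]; first exact: proj_dom_convex.
by have [] := dom j.+1.
Qed.

Lemma yhat_dom k : edom g (yhat k.+1).
Proof.
apply: (@average_in _ _ (edom g) t (fun k => y k.+1)) => // [u v s|j]; first exact: edom_convex.
by have [] := dom j.+1.
Qed.

(** Jensen is applied to the convex functions [phi _ v] and [gam - phi u]. The 6 is the 12 of
    [sum_weight_ge] halved by the factors 2 in the proximal denominators. *)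
Lemma ergodic_gap_le u v k : P u -> edom g v ->
  phi (xhat k.+1) v - gam v - (phi u (yhat k.+1) - gam (yhat k.+1))
  <= 6 / (nu * sigma 0%N * k.+1%:R ^+ 2) * D u v.
Proof.
move=> Pu gv.
set T := \sum_(0 <= i < k.+1) t i.
have T_ge : nu * sigma 0%N * k.+1%:R ^+ 2 / 12 <= T by exact: sum_weight_ge.
have T_gt0 : 0 < T.
  by apply: lt_le_trans T_ge; rewrite divr_gt0 // mulr_gt0 ?exprn_gt0 // mulr_gt0.
have D_ge0 : 0 <= D u v by rewrite addr_ge0 // mulr_ge0 ?exprn_ge0 // invr_ge0 ltW.
have jx : T * phi (xhat k.+1) v <= \sum_(0 <= j < k.+1) t j * phi (x j.+1) v.
  apply: (@jensen_average _ _ P _ (fun k => x k.+1) _ _ _ (fun u' => phi u' v))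
    => // [a b s|j|a b s].
  - exact: proj_dom_convex.
  - by have [] := dom j.+1.
  - by move=> Pa Pb; exact: phi_convex.
have jy : T * (gam (yhat k.+1) - phi u (yhat k.+1))
    <= \sum_(0 <= j < k.+1) t j * (gam (y j.+1) - phi u (y j.+1)).
  apply: (@jensen_average _ _ (edom g) _ (fun k => y k.+1) _ _ _
    (fun z => gam z - phi u z)) => // [a b s|j|a b s].
  - exact: edom_convex.
  - by have [] := dom j.+1.
  - move=> ga gb s01; have := gam_convex ga gb s01; have := phi_concave a b Pu s01; lra.
have main : T * (phi (xhat k.+1) v - gam v - (phi u (yhat k.+1) - gam (yhat k.+1))) <= D u v / 2.
  have := weighted_gap_le k.+1 Pu gv.
  have -> : \sum_(0 <= j < k.+1) t j * (phi (x j.+1) v - gam v - (phi u (y j.+1) - gam (y j.+1)))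
    = \sum_(0 <= j < k.+1) t j * phi (x j.+1) v - T * gam v
      + \sum_(0 <= j < k.+1) t j * (gam (y j.+1) - phi u (y j.+1)).
    rewrite mulr_suml -sumrB -big_split /=; apply: eq_bigr => j _; ring.
  have p1 : 0 <= `|u - x k.+1| ^+ 2 / (2 * tau 0%N).
    by rewrite divr_ge0 ?exprn_ge0 // mulr_ge0 // ltW.
  have p2 : 0 <= (1 - (c_alpha * Lyx * tau 0%N + 2 * Lyy) * sigma 0%N)
    * (t k.+1 ^+ 2 / (2 * sigma 0%N)) * `|v - y k.+1| ^+ 2.
    rewrite mulr_ge0 ?exprn_ge0 // mulr_ge0 ?subr_ge0 ?(ltW hstep) //.
    by rewrite divr_ge0 ?sqr_ge0 // mulr_ge0 // ltW.
  have -> : D u v / 2 = `|u - x 0%N| ^+ 2 / (2 * tau 0%N) + `|v - y 0%N| ^+ 2 / (2 * sigma 0%N).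
    by field; rewrite !gt_eqF.
  lra.
have s_gt0 : 0 < nu * sigma 0%N * k.+1%:R ^+ 2.
  by rewrite mulr_gt0 ?exprn_gt0 // mulr_gt0.
rewrite -(ler_pM2l T_gt0); apply: le_trans main _.
move: D_ge0; move: (D u v) => d d_ge0.
rewrite mulrA (mulrC d).
rewrite ler_wpM2r // mulrA ler_pdivlMr //; lra.
Qed.

(** At a saddle point every gap is nonnegative, so the final terms of [weighted_gap_le] are bounded
    by the initial ones. The strict step-size condition and [t k >= 1] keep the coefficient for [y]
    away from 0. *)
Lemma iterates_bounded xs ys : saddle_point (objective Phi g) xs ys ->
  (exists M, forall k, `|x k| <= M) /\ (exists M, forall k, `|y k| <= M).
Proof.
move=> sad; have [Pxs gys] := saddle_point_dom sad.
set delta := 1 - (c_alpha * Lyx * tau 0%N + 2 * Lyy) * sigma 0%N.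
have delta_gt0 : 0 < delta by rewrite subr_gt0.
set C := `|xs - x 0%N| ^+ 2 / (2 * tau 0%N) + `|ys - y 0%N| ^+ 2 / (2 * sigma 0%N).
have main k : `|xs - x k| ^+ 2 / (2 * tau 0%N)
    + delta * (t k ^+ 2 / (2 * sigma 0%N)) * `|ys - y k| ^+ 2 <= C.
  have := weighted_gap_le k Pxs gys.
  have : 0 <= \sum_(0 <= j < k) t j
      * (phi (x j.+1) ys - gam ys - (phi xs (y j.+1) - gam (y j.+1))).
    apply: sumr_ge0 => j _; rewrite mulr_ge0 ?(ltW (t_gt0 _)) // subr_ge0.
    have [Px gy] := dom j.+1; have [h1 h2] := sad (x j.+1) (y j.+1).
    by have := le_trans h1 h2; rewrite !objectiveE // lee_fin.
  rewrite -/delta -/C; lra.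
have p1 k : 0 <= `|xs - x k| ^+ 2 / (2 * tau 0%N).
  by rewrite divr_ge0 ?exprn_ge0 // mulr_ge0 // ltW.
have p2 k : delta / (2 * sigma 0%N) * `|ys - y k| ^+ 2
    <= delta * (t k ^+ 2 / (2 * sigma 0%N)) * `|ys - y k| ^+ 2.
  rewrite ler_wpM2r ?exprn_ge0 // ler_pM2l // ler_peMl ?invr_ge0 ?mulr_ge0 ?(ltW sigma0_gt0) //.
  by rewrite exprn_ege1 // (weight_ge1 nu_gt0 theta0 sigma0_gt0).
have C_ge0 : 0 <= C by rewrite addr_ge0 // divr_ge0 ?exprn_ge0 // mulr_ge0 // ltW.
(* This crude bound, from [2 z <= z^2 + 1], avoids square roots. *)
have sq (z B : R) : z ^+ 2 <= B -> z <= B + 1.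
  by move=> h; have := sqr_ge0 (z - 1); have := sqr_ge0 z; nra.
have bd (V : normedModType R) (a b : V) B : `|a - b| <= B -> `|b| <= `|a| + B.
  by move=> h; rewrite -[b in leLHS](subKr a); apply: le_trans (ler_normB _ _) _; rewrite lerD2l.
split.
  exists (`|xs| + (C * (2 * tau 0%N) + 1)) => k; apply/bd/sq.
  rewrite -ler_pdivrMr ?mulr_gt0 //.
  have := main k; have := p2 k.
  have : 0 <= delta / (2 * sigma 0%N) * `|ys - y k| ^+ 2.
    by rewrite mulr_ge0 ?exprn_ge0 // divr_ge0 ?mulr_ge0 // ltW.
  lra.
exists (`|ys| + (C * (2 * sigma 0%N) / delta + 1)) => k; apply/bd/sq.
rewrite ler_pdivlMr // -ler_pdivrMr ?mulr_gt0 //.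
have := main k; have := p2 k; have := p1 k.
lra.
Qed.

(** A closed ball is convex, so [average_in] applies to it. *)
Lemma averages_bounded (V : normedModType R) (z : nat -> V) :
  (exists M, forall k, `|z k| <= M) -> exists M, forall k, `|ergodic_average theta z k.+1| <= M.
Proof.
move=> [M hM]; exists M => k.
apply: (@average_in _ _ [set v : V | `|v| <= M] t (fun k => z k.+1))
  => //= u v s uM vM /andP[s0 s1].
have s1' : 0 <= 1 - s by rewrite subr_ge0.
apply: le_trans (ler_normD _ _) _; rewrite !normrZ (ger0_norm s0) (ger0_norm s1').
have := ler_wpM2l s0 uM; have := ler_wpM2l s1' vM; lra.
Qed.

End Rate.
End Problem.

(** * Assembly of the bounds into the theorem *)

Unset Implicit Arguments.

Theorem theorem3p5 (R : realType) (H1 H2 : completeNormedModType R)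
    (ip1 : {dot H1 for idfun}) (ip2 : {dot H2 for idfun})
    (hH1 : hilbert_inner ip1) (hH2 : hilbert_inner ip2)
    (Phi : H1 -> H2 -> \bar R) (g : H2 -> \bar R) (nu Lyx Lyy : R)
    (hsa : standing_assumptions ip2 Phi g nu Lyx Lyy) (hnu : 0 < nu)
    (xs : H1) (ys : H2) (hsaddle : saddle_point (objective Phi g) xs ys)
    (c_alpha : R) (hc : Lyx < c_alpha)
    (sigma tau theta : nat -> R)
    (htheta0 : theta 0%N = 1) (htau0 : 0 < tau 0%N) (hsigma0 : 0 < sigma 0%N)
    (hstep : (c_alpha * Lyx * tau 0%N + 2 * Lyy) * sigma 0%N < 1)
    (hsigma0_le : sigma 0%N <= (9 + 3 * Num.sqrt 13) / (2 * nu))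
    (htheta : forall k : nat, theta k.+1 = (Num.sqrt (1 + nu * sigma k))^-1)
    (htau : forall k : nat, tau k.+1 = tau k / theta k.+1)
    (hsigma : forall k : nat, sigma k.+1 = theta k.+1 * sigma k)
    (x : nat -> H1) (y : nat -> H2)
    (halg : OGAProx ip2 Phi g sigma tau theta x y) :
  let f := objective Phi g in
  let xhat := ergodic_average theta x in
  let yhat := ergodic_average theta y in
  [/\ bounded_fun (fun k : nat => (x k, y k)),
      bounded_fun (fun k : nat => (xhat k.+1, yhat k.+1)),
      forall k : nat, (0 < k)%N ->
        ((- (6 / (nu * sigma 0%N * k%:R ^+ 2)
             * ((tau 0%N)^-1 * `|xhat k - x 0%N| ^+ 2
                + (sigma 0%N)^-1 * `|ys - y 0%N| ^+ 2)))%:E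
           <= f (xhat k) (yhat k) - f xs ys)%E /\
        (f (xhat k) (yhat k) - f xs ys
           <= (6 / (nu * sigma 0%N * k%:R ^+ 2)
               * ((tau 0%N)^-1 * `|xs - x 0%N| ^+ 2
                  + (sigma 0%N)^-1 * `|yhat k - y 0%N| ^+ 2))%:E)%E,
      (fun k : nat => f (xhat k) (yhat k)) @ \oo --> f xs ys &
      (fun k : nat => fine (f (xhat k) (yhat k) - f xs ys)%E : R^o)
        =O_\oo (fun k : nat => (k%:R ^+ 2)^-1 : R^o)].
Proof.
move=> f xhat yhat.
have [Pxs gys] := saddle_point_dom hsa hsaddle.
have xd k : proj_dom Phi (xhat k.+1)
  by exact: (xhat_dom hsa hnu htheta0 htau0 hsigma0 htheta htau hsigma halg).
have yd k : edom g (yhat k.+1)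
  by exact: (yhat_dom hH2 hsa hnu htheta0 htau0 hsigma0 htheta htau hsigma halg).
have gap :=
  ergodic_gap_le hH1 hH2 hsa hnu hc htheta0 htau0 hsigma0 hstep hsigma0_le htheta htau hsigma halg.
have [bx by_] :=
  iterates_bounded hH1 hH2 hsa hnu hc htheta0 htau0 hsigma0 hstep htheta htau hsigma halg hsaddle.
have avg_bd := averages_bounded hnu htheta0 hsigma0 htheta hsigma.
have [[Mx hMx] [My hMy]] := (avg_bd _ x bx, avg_bd _ y by_).
pose F u v : R := finite_part (Phi u) v - finite_part g v.
have fE k : f (xhat k.+1) (yhat k.+1) = (F (xhat k.+1) (yhat k.+1))%:E.
  exact: (objectiveE hsa).
have fsE : f xs ys = (F xs ys)%:E by exact: (objectiveE hsa).
(* The gap is taken at [u = xhat], [v = ys], and the saddle inequality replaces [F xhat ys] by the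
   smaller [F xs ys]. *)
have lower k : - (6 / (nu * sigma 0%N * k.+1%:R ^+ 2)
     * ((tau 0%N)^-1 * `|xhat k.+1 - x 0%N| ^+ 2 + (sigma 0%N)^-1 * `|ys - y 0%N| ^+ 2))
   <= F (xhat k.+1) (yhat k.+1) - F xs ys.
  have := gap _ _ k (xd k) gys; have [_] := hsaddle (xhat k.+1) ys.
  rewrite !(objectiveE hsa) // lee_fin => h1 h2.
  rewrite lerNl; apply: le_trans h2; rewrite /F -/xhat -/yhat. lra.
(* Symmetrically, with [u = xs], [v = yhat]. *)
have upper k : F (xhat k.+1) (yhat k.+1) - F xs ys <= 6 / (nu * sigma 0%N * k.+1%:R ^+ 2)
     * ((tau 0%N)^-1 * `|xs - x 0%N| ^+ 2 + (sigma 0%N)^-1 * `|yhat k.+1 - y 0%N| ^+ 2).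
  have := gap _ _ k Pxs (yd k); have [+ _] := hsaddle xs (yhat k.+1).
  rewrite !(objectiveE hsa) // lee_fin => h1 h2.
  by apply: le_trans h2; rewrite /F -/xhat -/yhat; lra.
(* The radii [|xs| + Mx] and [|ys| + My] cover both comparison points, so one constant serves the
   two bounds. *)
pose C := 6 / (nu * sigma 0%N) * ((tau 0%N)^-1 * ((`|xs| + Mx + `|x 0%N|) ^+ 2)
  + (sigma 0%N)^-1 * ((`|ys| + My + `|y 0%N|) ^+ 2)).
have C_ge0 : 0 <= C.
  rewrite mulr_ge0 // ?divr_ge0 ?mulr_ge0 ?(ltW hnu) ?(ltW hsigma0) //.
  by rewrite addr_ge0 // mulr_ge0 ?sqr_ge0 // invr_ge0 ltW.
have rate k : `|F (xhat k.+1) (yhat k.+1) - F xs ys| <= C * (k.+1%:R ^+ 2)^-1.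
  have CE : C * (k.+1%:R ^+ 2)^-1 = 6 / (nu * sigma 0%N * k.+1%:R ^+ 2)
      * ((tau 0%N)^-1 * ((`|xs| + Mx + `|x 0%N|) ^+ 2)
         + (sigma 0%N)^-1 * ((`|ys| + My + `|y 0%N|) ^+ 2)).
    by rewrite /C; field; rewrite !gt_eqF.
  have c_ge0 : 0 <= 6 / (nu * sigma 0%N * k.+1%:R ^+ 2).
    by rewrite divr_ge0 // !mulr_ge0 ?(ltW hnu) ?(ltW hsigma0).
  have sq (V : normedModType R) (a b : V) (r : R) : `|a| <= r -> `|a - b| ^+ 2 <= (r + `|b|) ^+ 2.
    move=> ar; have h : `|a - b| <= r + `|b| by apply: le_trans (ler_normB _ _) _; rewrite lerD2r.
    by rewrite lerXn2r ?nnegrE // (le_trans _ h).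
  have Mx_ge0 : 0 <= Mx by exact: le_trans (hMx 0%N).
  have My_ge0 : 0 <= My by exact: le_trans (hMy 0%N).
  have h1 (u : H1) (v : H2) : `|u| <= `|xs| + Mx -> `|v| <= `|ys| + My ->
      6 / (nu * sigma 0%N * k.+1%:R ^+ 2)
      * ((tau 0%N)^-1 * `|u - x 0%N| ^+ 2 + (sigma 0%N)^-1 * `|v - y 0%N| ^+ 2)
      <= C * (k.+1%:R ^+ 2)^-1.
    move=> hu hv; rewrite CE ler_wpM2l // lerD // ler_wpM2l ?invr_ge0 ?sq //; exact: ltW.
  rewrite ler_norml; apply/andP; split.
    apply: le_trans (lower k); rewrite lerN2; apply: h1.
      by apply: le_trans (hMx k) _; rewrite lerDr.
    by rewrite lerDl.
  apply: le_trans (upper k) _; apply: h1; first by rewrite lerDl.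
  by apply: le_trans (hMy k) _; rewrite lerDr.
have bd_pair (u : nat -> H1) (v : nat -> H2) : (exists M, forall k, `|u k| <= M) ->
    (exists M, forall k, `|v k| <= M) -> bounded_fun (fun k => (u k, v k)).
  move=> [M hM] [N hN]; apply: (@bounded_funW _ _ _ (Order.max M N)) => k.
  by rewrite prod_normE /= ge_max !le_max hM hN orbT.
split.
- exact: bd_pair.
- by apply: bd_pair; [exists Mx|exists My].
- by case=> // k _; rewrite fE fsE -EFinB !lee_fin.
(* The shift discards index 0, where the average is an empty sum. *)
- rewrite fsE -cvg_shiftS /=.
  under eq_fun do rewrite fE.
  apply: cvg_EFin => //; first exact: nearW.
  (* The rate [C / (k+1)^2] is relaxed to [C / (k+1)], so that the harmonic sequence can squeeze. *)
  have hC : C *: (fun k : nat => k.+1%:R^-1) @ \oo --> (0 : R).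
    by rewrite -[X in _ --> X](scaler0 _ C); apply: cvgZr; exact: cvg_harmonic.
  apply: (@squeeze_cvgr _ _ _ _ (fun k : nat => F xs ys - C * k.+1%:R^-1)
    (fun k : nat => F xs ys + C * k.+1%:R^-1)).
  + apply: nearW => k /=; rewrite -ler_distl; apply: le_trans (rate k) _.
    by rewrite ler_wpM2l // lef_pV2 ?posrE ?exprn_gt0 // expr2 ler_peMr // ler1n.
  + by rewrite -[X in _ --> X]subr0; apply: cvgB => //; exact: cvg_cst.
  + by rewrite -[X in _ --> X]addr0; apply: cvgD => //; exact: cvg_cst.
(* [C + 1] is used because the constant must be positive and [C] is only known to be nonnegative. *)
- apply/eqO_exP; exists (C + 1); first by rewrite ltr_wpDl.
  exists 1%N => // -[//|k] _ /=.
  rewrite fE fsE -EFinB /=; apply: le_trans (rate k) _.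
  rewrite [X in _ <= _ * X]ger0_norm ?invr_ge0 ?exprn_ge0 //.
  by rewrite ler_wpM2r ?invr_ge0 ?exprn_ge0 // lerDl.
Qed.
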